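(* If a labelled sequent $\mathcal{G};\Gamma\vdash\Delta$ is derivable in the calculus $LS_{PASL}$, then it is derivable in $LS_{PASL}$ without using the $cut$ rule.
   Context: Formulae: $A ::= p \mid \top\mid\bot\mid\neg A\mid A\vee A\mid A\wedge A\mid A\to A\mid \top^*\mid A*A\mid A\mathrel{-\!\!*}A$, $p$ a propositional variable. Labels are elements of $LVar\cup\{\epsilon\}$, $LVar$ an infinite set of label variables, $\epsilon$ a label constant. A labelled formula is $a:A$; a relational atom is $(a,b\triangleright c)$ for labels $a,b,c$. A sequent $\mathcal{G};\Gamma\vdash\Delta$ consists of a set $\mathcal{G}$ of relational atoms and multisets $\Gamma,\Delta$ of labelled formulae; commas denote union. For a label variable $x$ and label $y$, $\mathcal{G}[y/x],\Gamma[y/x],\Delta[y/x]$ denote uniform replacement of $x$ by $y$. There are no rules for $\neg,\vee$: $\neg A$ abbreviates $A\to\bot$ and $A\vee B$ abbreviates $\neg A\to B$. Rules of $LS_{PASL}$ (premises $\Rightarrow$ conclusion; ''fresh'' = a label variable not occurring in the conclusion): $id$: axiom $\mathcal{G};\Gamma,w:p\vdash w:p,\Delta$. $cut$: $\mathcal{G};\Gamma\vdash x:A,\Delta$ and $\mathcal{G}';\Gamma',x:A\vdash\Delta'$ $\Rightarrow$ $\mathcal{G},\mathcal{G}';\Gamma,\Gamma'\vdash\Delta,\Delta'$. $\bot L$: axiom $\mathcal{G};\Gamma,w:\bot\vdash\Delta$. $\top R$: axiom $\mathcal{G};\Gamma\vdash w:\top,\Delta$. $\top^*R$: axiom $\mathcal{G};\Gamma\vdash\epsilon:\top^*,\Delta$.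 $\top^*L$: $(\epsilon,w\triangleright\epsilon),\mathcal{G};\Gamma\vdash\Delta\Rightarrow\mathcal{G};\Gamma,w:\top^*\vdash\Delta$. $\wedge L$: $\mathcal{G};\Gamma,w:A,w:B\vdash\Delta\Rightarrow\mathcal{G};\Gamma,w:A\wedge B\vdash\Delta$. $\wedge R$: $\mathcal{G};\Gamma\vdash w:A,\Delta$ and $\mathcal{G};\Gamma\vdash w:B,\Delta\Rightarrow\mathcal{G};\Gamma\vdash w:A\wedge B,\Delta$. $\to L$: $\mathcal{G};\Gamma\vdash w:A,\Delta$ and $\mathcal{G};\Gamma,w:B\vdash\Delta\Rightarrow\mathcal{G};\Gamma,w:A\to B\vdash\Delta$. $\to R$: $\mathcal{G};\Gamma,w:A\vdash w:B,\Delta\Rightarrow\mathcal{G};\Gamma\vdash w:A\to B,\Delta$. $*L$: $(x,y\triangleright z),\mathcal{G};\Gamma,x:A,y:B\vdash\Delta\Rightarrow\mathcal{G};\Gamma,z:A*B\vdash\Delta$ ($x,y$ fresh). $\mathrel{-\!\!*}R$: $(x,z\triangleright y),\mathcal{G};\Gamma,x:A\vdash y:B,\Delta\Rightarrow\mathcal{G};\Gamma\vdash z:A\mathrel{-\!\!*}B,\Delta$ ($x,y$ fresh). $*R$: $(x,y\triangleright z),\mathcal{G};\Gamma\vdash x:A,z:A*B,\Delta$ and $(x,y\triangleright z),\mathcal{G};\Gamma\vdash y:B,z:A*B,\Delta\Rightarrow(x,y\triangleright z),\mathcal{G};\Gamma\vdash z:A*B,\Delta$. $\mathrel{-\!\!*}L$: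 $(x,y\triangleright z),\mathcal{G};\Gamma,y:A\mathrel{-\!\!*}B\vdash x:A,\Delta$ and $(x,y\triangleright z),\mathcal{G};\Gamma,y:A\mathrel{-\!\!*}B,z:B\vdash\Delta\Rightarrow(x,y\triangleright z),\mathcal{G};\Gamma,y:A\mathrel{-\!\!*}B\vdash\Delta$. $E$: $(y,x\triangleright z),(x,y\triangleright z),\mathcal{G};\Gamma\vdash\Delta\Rightarrow(x,y\triangleright z),\mathcal{G};\Gamma\vdash\Delta$. $A$: $(u,w\triangleright z),(y,v\triangleright w),(x,y\triangleright z),(u,v\triangleright x),\mathcal{G};\Gamma\vdash\Delta\Rightarrow(x,y\triangleright z),(u,v\triangleright x),\mathcal{G};\Gamma\vdash\Delta$ ($w$ fresh). $U$: $(x,\epsilon\triangleright x),\mathcal{G};\Gamma\vdash\Delta\Rightarrow\mathcal{G};\Gamma\vdash\Delta$. $A_C$: $(x,w\triangleright x),(y,y\triangleright w),(x,y\triangleright x),\mathcal{G};\Gamma\vdash\Delta\Rightarrow(x,y\triangleright x),\mathcal{G};\Gamma\vdash\Delta$ ($w$ fresh). $Eq_1$: $(\epsilon,w'\triangleright w'),\mathcal{G}[w'/w];\Gamma[w'/w]\vdash\Delta[w'/w]\Rightarrow(\epsilon,w\triangleright w'),\mathcal{G};\Gamma\vdash\Delta$. $Eq_2$: same premise $\Rightarrow(\epsilon,w'\triangleright w),\mathcal{G};\Gamma\vdash\Delta$. $P$: $(x,y\triangleright z),\mathcal{G}[z/w];\Gamma[z/w]\vdash\Delta[z/w]\Rightarrow(x,y\triangleright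 z),(x,y\triangleright w),\mathcal{G};\Gamma\vdash\Delta$. $C$: $(x,y\triangleright z),\mathcal{G}[y/w];\Gamma[y/w]\vdash\Delta[y/w]\Rightarrow(x,y\triangleright z),(x,w\triangleright z),\mathcal{G};\Gamma\vdash\Delta$. In $Eq_1,Eq_2,P,C$ the label $w$ substituted for must be a label variable. *)

(* Defs.v *)
From HB Require Import structures.
From mathcomp Require Import all_boot.
From mathcomp Require Import finmap multiset.

Set Implicit Arguments.
Unset Strict Implicit.
Unset Printing Implicit Defensive.

Local Open Scope mset_scope.
Local Open Scope fset_scope.

Inductive form (PVar : Type) : Type :=
| Var of PVar
| Top
| Bot
| And of form PVar & form PVar
| Imp of form PVar & form PVar
| Emp (* the multiplicative unit, written \top^* *)
| Star of form PVar & form PVar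
| Wand of form PVar & form PVar.

Arguments Top {PVar}.
Arguments Bot {PVar}.
Arguments Emp {PVar}.

(* The calculus has no rules for negation and disjunction: they are
   abbreviations rather than constructors. *)
Definition Neg (PVar : Type) (A : form PVar) : form PVar := Imp A Bot.
Definition Or (PVar : Type) (A B : form PVar) : form PVar := Imp (Neg A) B.

Fixpoint form_encode (PVar : Type) (A : form PVar) : GenTree.tree PVar :=
  match A with
  | Var p => GenTree.Leaf p
  | Top => GenTree.Node 0 [::]
  | Bot => GenTree.Node 1 [::]
  | And A B => GenTree.Node 2 [:: form_encode A; form_encode B]
  | Imp A B => GenTree.Node 3 [:: form_encode A; form_encode B]
  | Emp => GenTree.Node 4 [::]
  | Star A B => GenTree.Node 5 [:: form_encode A; form_encode B]
  | Wand A B => GenTree.Node 6 [:: form_encode A; form_encode B]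
  end.

Fixpoint form_decode (PVar : Type) (t : GenTree.tree PVar) : form PVar :=
  match t with
  | GenTree.Leaf p => Var p
  | GenTree.Node 0 _ => Top
  | GenTree.Node 1 _ => Bot
  | GenTree.Node 2 [:: a; b] => And (form_decode a) (form_decode b)
  | GenTree.Node 3 [:: a; b] => Imp (form_decode a) (form_decode b)
  | GenTree.Node 4 _ => Emp
  | GenTree.Node 5 [:: a; b] => Star (form_decode a) (form_decode b)
  | GenTree.Node 6 [:: a; b] => Wand (form_decode a) (form_decode b)
  | _ => Top
  end.

Lemma form_encodeK (PVar : Type) :
  cancel (@form_encode PVar) (@form_decode PVar).
Proof. by elim=> //= A -> B ->. Qed.

HB.instance Definition _ (PVar : choiceType) :=
  Choice.copy (form PVar) (can_type (@form_encodeK PVar)).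

Inductive label (LVar : Type) : Type := Eps | Lab of LVar.

Arguments Eps {LVar}.

Definition label_encode (LVar : Type) (a : label LVar) : option LVar :=
  if a is Lab x then Some x else None.

Definition label_decode (LVar : Type) (o : option LVar) : label LVar :=
  if o is Some x then Lab x else Eps.

Lemma label_encodeK (LVar : Type) :
  cancel (@label_encode LVar) (@label_decode LVar).
Proof. by case. Qed.

HB.instance Definition _ (LVar : choiceType) :=
  Choice.copy (label LVar) (can_type (@label_encodeK LVar)).

(* The triple (a, b, c) is the relational atom (a, b |> c), and the pair (a, A)
   is the labelled formula a : A. *)
Notation ratom LVar := (label LVar * label LVar * label LVar)%type.
Notation lform PVar LVar := (label LVar * form PVar)%type.

(* [subst_* y x] replaces the label variable x by the label y. *)
Definition subst_label (LVar : choiceType) (y : label LVar) (x : LVar)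
    (a : label LVar) : label LVar :=
  if a == Lab x then y else a.

Definition subst_ratom (LVar : choiceType) (y : label LVar) (x : LVar)
    (r : ratom LVar) : ratom LVar :=
  (subst_label y x r.1.1, subst_label y x r.1.2, subst_label y x r.2).

Definition subst_lform (PVar LVar : choiceType) (y : label LVar) (x : LVar)
    (F : lform PVar LVar) : lform PVar LVar :=
  (subst_label y x F.1, F.2).

Definition subst_rel (LVar : choiceType) (y : label LVar) (x : LVar)
    (G : {fset ratom LVar}) : {fset ratom LVar} :=
  [fset subst_ratom y x r | r in G].

(* The image of a multiset, multiplicities being added up. *)
Definition subst_ctx (PVar LVar : choiceType) (y : label LVar) (x : LVar)
    (X : {mset lform PVar LVar}) : {mset lform PVar LVar} :=
  seq_mset [seq subst_lform y x F | F <- enum_mset X].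

Definition fresh (PVar LVar : choiceType) (x : LVar) (G : {fset ratom LVar})
    (X Y : {mset lform PVar LVar}) : Prop :=
  [/\ forall r, r \in G -> Lab x \notin [:: r.1.1; r.1.2; r.2],
      forall F, F \in X -> Lab x != F.1
    & forall F, F \in Y -> Lab x != F.1].

(* [LS_PASL c G X Y]: the sequent G; X |- Y has a derivation, in which the cut
   rule may be used only if [c] is true.  On sets of relational atoms the comma
   is set union, so that G may itself contain the atoms displayed before it; on
   multisets it is the sum [`+`], not the pointwise maximum [`|`]. *)
Inductive LS_PASL (PVar LVar : choiceType) (c : bool) :
    {fset ratom LVar} -> {mset lform PVar LVar} -> {mset lform PVar LVar} ->
    Prop :=
| rule_id G X Y w p :
    LS_PASL c G ((w, Var p) +` X) ((w, Var p) +` Y)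
| rule_cut G G' X X' Y Y' x A :
    c ->
    LS_PASL c G X ((x, A) +` Y) ->
    LS_PASL c G' ((x, A) +` X') Y' ->
    LS_PASL c (G `|` G') (X `+` X') (Y `+` Y')
| rule_BotL G X Y w :
    LS_PASL c G ((w, Bot) +` X) Y
| rule_TopR G X Y w :
    LS_PASL c G X ((w, Top) +` Y)
| rule_EmpR G X Y :
    LS_PASL c G X ((Eps, Emp) +` Y)
| rule_EmpL G X Y w :
    LS_PASL c ((Eps, w, Eps) |` G) X Y ->
    LS_PASL c G ((w, Emp) +` X) Y
| rule_AndL G X Y w A B :
    LS_PASL c G ((w, A) +` ((w, B) +` X)) Y ->
    LS_PASL c G ((w, And A B) +` X) Y
| rule_AndR G X Y w A B :
    LS_PASL c G X ((w, A) +` Y) ->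
    LS_PASL c G X ((w, B) +` Y) ->
    LS_PASL c G X ((w, And A B) +` Y)
| rule_ImpL G X Y w A B :
    LS_PASL c G X ((w, A) +` Y) ->
    LS_PASL c G ((w, B) +` X) Y ->
    LS_PASL c G ((w, Imp A B) +` X) Y
| rule_ImpR G X Y w A B :
    LS_PASL c G ((w, A) +` X) ((w, B) +` Y) ->
    LS_PASL c G X ((w, Imp A B) +` Y)
| rule_StarL G X Y (x y : LVar) z A B :
    x != y ->
    fresh x G ((z, Star A B) +` X) Y ->
    fresh y G ((z, Star A B) +` X) Y ->
    LS_PASL c ((Lab x, Lab y, z) |` G) ((Lab x, A) +` ((Lab y, B) +` X)) Y ->
    LS_PASL c G ((z, Star A B) +` X) Y
| rule_WandR G X Y (x y : LVar) z A B :
    x != y ->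
    fresh x G X ((z, Wand A B) +` Y) ->
    fresh y G X ((z, Wand A B) +` Y) ->
    LS_PASL c ((Lab x, z, Lab y) |` G) ((Lab x, A) +` X) ((Lab y, B) +` Y) ->
    LS_PASL c G X ((z, Wand A B) +` Y)
| rule_StarR G X Y x y z A B :
    LS_PASL c ((x, y, z) |` G) X ((x, A) +` ((z, Star A B) +` Y)) ->
    LS_PASL c ((x, y, z) |` G) X ((y, B) +` ((z, Star A B) +` Y)) ->
    LS_PASL c ((x, y, z) |` G) X ((z, Star A B) +` Y)
| rule_WandL G X Y x y z A B :
    LS_PASL c ((x, y, z) |` G) ((y, Wand A B) +` X) ((x, A) +` Y) ->
    LS_PASL c ((x, y, z) |` G) ((y, Wand A B) +` ((z, B) +` X)) Y ->
    LS_PASL c ((x, y, z) |` G) ((y, Wand A B) +` X) Y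
| rule_E G X Y x y z :
    LS_PASL c ((y, x, z) |` ((x, y, z) |` G)) X Y ->
    LS_PASL c ((x, y, z) |` G) X Y
| rule_A G X Y x y z u v (w : LVar) :
    fresh w ((x, y, z) |` ((u, v, x) |` G)) X Y ->
    LS_PASL c ((u, Lab w, z) |` ((y, v, Lab w) |`
                 ((x, y, z) |` ((u, v, x) |` G)))) X Y ->
    LS_PASL c ((x, y, z) |` ((u, v, x) |` G)) X Y
| rule_U G X Y x :
    LS_PASL c ((x, Eps, x) |` G) X Y ->
    LS_PASL c G X Y
| rule_AC G X Y x y (w : LVar) :
    fresh w ((x, y, x) |` G) X Y ->
    LS_PASL c ((x, Lab w, x) |` ((y, y, Lab w) |` ((x, y, x) |` G))) X Y ->
    LS_PASL c ((x, y, x) |` G) X Y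
| rule_Eq1 G X Y (w : LVar) w' :
    LS_PASL c ((Eps, w', w') |` subst_rel w' w G)
      (subst_ctx w' w X) (subst_ctx w' w Y) ->
    LS_PASL c ((Eps, Lab w, w') |` G) X Y
| rule_Eq2 G X Y (w : LVar) w' :
    LS_PASL c ((Eps, w', w') |` subst_rel w' w G)
      (subst_ctx w' w X) (subst_ctx w' w Y) ->
    LS_PASL c ((Eps, w', Lab w) |` G) X Y
| rule_P G X Y x y z (w : LVar) :
    LS_PASL c ((x, y, z) |` subst_rel z w G)
      (subst_ctx z w X) (subst_ctx z w Y) ->
    LS_PASL c ((x, y, z) |` ((x, y, Lab w) |` G)) X Y
| rule_C G X Y x y z (w : LVar) :
    LS_PASL c ((x, y, z) |` subst_rel y w G)
      (subst_ctx y w X) (subst_ctx y w Y) ->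
    LS_PASL c ((x, y, z) |` ((x, Lab w, z) |` G)) X Y.

Notation derivable := (LS_PASL true).
Notation cut_free_derivable := (LS_PASL false).

(* Main.v *)
Require Import Defs.
From mathcomp Require Import all_boot.
From mathcomp Require Import finmap multiset.

(* Cut-free derivability is used as the answer type of a continuation semantics.
   Sequents are the worlds of a Kripke-like model; a formula is forced when it
   is true, and refuted when forcing it at any later world makes that world
   cut-free derivable.  With this notion of refutation the cut rule is sound for
   trivial reasons, and so is every other rule, because the structural rules
   move from a world to a later one.  Conversely each formula on the left
   (right) of a world may be assumed forced (is refuted) there, by the logical
   rules, so evaluating a derivation at its own end-sequent removes the cuts.
   The order between worlds allows label maps, weakening, and the replacement
   of a formula by its components under an invertible rule, which is what makes
   a separate treatment of substitution, inversion and contraction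
   unnecessary. *)

Set Implicit Arguments.
Unset Strict Implicit.
Unset Printing Implicit Defensive.

Local Open Scope mset_scope.
Local Open Scope fset_scope.

Section Forcing.

Variables PVar LVar : choiceType.

Local Notation lab := (label LVar).
Local Notation fml := (form PVar).

(** * Worlds, coverage and the order between worlds *)

Record world := World {
  rels : {fset ratom LVar};
  ante : {mset lform PVar LVar};
  succ : {mset lform PVar LVar} }.

Definition side (b : bool) (W : world) := if b then ante W else succ W.

Definition cut_free (W : world) := LS_PASL false (rels W) (ante W) (succ W).

Definition map_ratom (s : lab -> lab) (r : ratom LVar) : ratom LVar :=
  (s r.1.1, s r.1.2, s r.2).

(* [b] selects the side: left (antecedent) if true, right (succedent) if false.
   A formula is covered if it, or the components that its invertible rules
   leave behind, hereditarily occur in the sequent. *)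
Fixpoint covered (b : bool) (W : world) (A : fml) (a : lab) : Prop :=
  (a, A) \in side b W \/
  match A, b with
  | And B C, true => covered true W B a /\ covered true W C a
  | And B C, false => covered false W B a \/ covered false W C a
  | Imp B C, true => covered false W B a \/ covered true W C a
  | Imp B C, false => covered true W B a /\ covered false W C a
  | Emp, true => (Eps, a, Eps) \in rels W
  | Star B C, true => exists x y,
      [/\ (x, y, a) \in rels W, covered true W B x & covered true W C y]
  | Wand B C, false => exists x y,
      [/\ (x, a, y) \in rels W, covered true W B x & covered false W C y]
  | _, _ => False
  end.

(** Only membership matters and [s] need not be injective, so copies of a formula may be dropped and
    labels may be merged. Asking for [covered] rather than membership makes the premise of an
    invertible rule a world later than its conclusion. *)
Definition le (s : lab -> lab) (W W' : world) : Prop :=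
  [/\ s Eps = Eps,
      forall r, r \in rels W -> map_ratom s r \in rels W'
    & forall b F, F \in side b W -> covered b W' F.2 (s F.1)].

Lemma coveredW b W A a : (a, A) \in side b W -> covered b W A a.
Proof. by case: A => *; left. Qed.

(** An occurrence is carried over by the definition of [le]; coverage through components follows by
    induction on [A]. Transitivity of the order rests on this. *)
Lemma covered_le s W W' b A a :
  le s W W' -> covered b W A a -> covered b W' A (s a).
Proof.
move=> [s0 hr hc].
elim: A b a => [p|||B IHB C IHC|B IHB C IHC||B IHB C IHC|B IHB C IHC]
    b a /= [/hc//|]; case: b => //.
- by case=> /IHB ? /IHC ?; right.
- by case=> [/IHB|/IHC] ?; right; [left|right].
- by case=> [/IHB|/IHC] ?; right; [left|right].
- by case=> /IHB ? /IHC ?; right.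
- by move/hr; rewrite /map_ratom /= s0; right.
- by case=> x [y [/hr ? /IHB ? /IHC ?]]; right; exists (s x), (s y).
- by case=> x [y [/hr ? /IHB ? /IHC ?]]; right; exists (s x), (s y).
Qed.

Lemma le_id W W' : {subset rels W <= rels W'} ->
  (forall b F, F \in side b W -> covered b W' F.2 F.1) -> le id W W'.
Proof. by move=> hr hc; split=> // -[[x y] z] /hr. Qed.

Lemma le_refl W : le id W W.
Proof. by apply: le_id => // b [a A]; apply: coveredW. Qed.

Lemma le_trans s t W W' W'' : le s W W' -> le t W' W'' -> le (t \o s) W W''.
Proof.
move=> [s0 sr sc] tt; have [t0 tr tc] := tt; split=> /=; first by rewrite s0.
  by move=> r /sr/tr.
by move=> b F /sc; apply: covered_le.
Qed.

(** * Forcing and refutation *)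

(* In the cases of [Imp] and [Wand] the innermost hypothesis is [refute C],
   inlined because [refute] is defined from [force]. *)
Fixpoint force (A : fml) (W : world) (a : lab) : Prop :=
  match A with
  | Var p => (a, Var p) \in ante W
  | Top => True
  | Bot => False
  | And B C => force B W a /\ force C W a
  | Imp B C => forall s W', le s W W' -> force B W' (s a) ->
      (forall t W'', le t W' W'' -> force C W'' (t (s a)) -> cut_free W'') ->
      cut_free W'
  | Emp => (Eps, a, Eps) \in rels W
  | Star B C => exists x y,
      [/\ (x, y, a) \in rels W, force B W x & force C W y]
  | Wand B C => forall s W' x y, le s W W' -> (x, s a, y) \in rels W' ->
      force B W' x ->
      (forall t W'', le t W' W'' -> force C W'' (t y) -> cut_free W'') ->
      cut_free W'
  end.

(** Kripke negation with [cut_free] as falsity. In these terms [force] reads [Imp B C] classically,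
    as the negation of: [B] and not [C]. *)
Definition refute (A : fml) (W : world) (a : lab) : Prop :=
  forall s W', le s W W' -> force A W' (s a) -> cut_free W'.

(** [Imp] and [Wand] quantify over all later worlds, so composition of maps suffices. For a
    variable, coverage on the left is plain occurrence; for [Emp] the condition [s Eps = Eps] is
    needed. *)
Lemma force_le A s W W' a : le s W W' -> force A W a -> force A W' (s a).
Proof.
move=> ss; have [s0 sr sc] := ss.
elim: A a => [p|||B IHB C IHC|B _ C _||B IHB C IHC|B _ C _] a //=.
- by move=> h; case: (sc true _ h).
- by case=> /IHB ? /IHC.
- by move=> h t W'' tt; apply: h (le_trans ss tt).
- by move/sr; rewrite /map_ratom /= s0.
- by case=> x [y [/sr ? /IHB ? /IHC ?]]; exists (s x), (s y).
- by move=> h t W'' x y tt; apply: h (le_trans ss tt).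
Qed.

Lemma refute_le A s W W' a : le s W W' -> refute A W a -> refute A W' (s a).
Proof. by move=> ss h t W'' tt; apply: h (le_trans ss tt). Qed.

Lemma refute_force A W a : refute A W a -> force A W a -> cut_free W.
Proof. by move=> h; apply: h (le_refl W). Qed.

(** * Fresh labels and elementary extensions of a world *)

Lemma in_mset_rem (F P : lform PVar LVar) (X : {mset lform PVar LVar}) :
  F \in X -> F = P \/ F \in (X `\ P)%mset.
Proof.
move=> FX; case: (eqVneq F P) => [|/negPf nFP]; first by left.
by right; rewrite in_msetB1 nFP FX.
Qed.

Lemma fresh_exists (LVar_infinite : forall s : seq LVar, exists x, x \notin s)
    (G : {fset ratom LVar}) (X Y : {mset lform PVar LVar}) (s : seq LVar) :
  exists2 x, fresh x G X Y & x \notin s.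
Proof.
pose ls := flatten [seq [:: r.1.1; r.1.2; r.2] | r <- G] ++
           [seq F.1 | F <- enum_mset X] ++ [seq F.1 | F <- enum_mset Y].
have [x] := LVar_infinite (pmap (@label_encode LVar) ls ++ s).
rewrite mem_cat negb_or => /andP[xls xs]; exists x => //.
have {xls} xls : Lab x \notin ls.
  apply: contra xls => xls; rewrite mem_pmap.
  by apply/mapP; exists (Lab x).
move: xls; rewrite /ls !mem_cat !negb_or => /and3P[hG hX hY]; split.
- move=> r rG; apply: contra hG => hx; apply/flattenP.
  by exists [:: r.1.1; r.1.2; r.2] => //; apply/mapP; exists r.
- move=> F FX; apply: contra hX => /eqP ->; apply: map_f.
  exact: FX.
- move=> F FX; apply: contra hY => /eqP ->; apply: map_f.
  exact: FX.
Qed.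

Definition add_rel (r : ratom LVar) (W : world) :=
  World (r |` rels W) (ante W) (succ W).

Lemma le_add_rel r W : le id W (add_rel r W).
Proof.
apply: le_id => [q|[] [a A] /= h]; first exact: fset1Ur.
  exact: coveredW.
exact: coveredW.
Qed.

Lemma le_add_ante F W : le id W (World (rels W) (F +` ante W)%mset (succ W)).
Proof.
apply: le_id => // -[] [a A] h; apply: coveredW => //.
by rewrite /= in_mset1D [X in _ || X]h orbT.
Qed.

Lemma le_add_succ F W : le id W (World (rels W) (ante W) (F +` succ W)%mset).
Proof.
apply: le_id => // -[] [a A] h; apply: coveredW => //.
by rewrite /= in_mset1D [X in _ || X]h orbT.
Qed.

(** * Substitution as a passage to a later world, and unification of labels *)

Lemma in_subst_ctx y x (F : lform PVar LVar) X :
  F \in X -> subst_lform y x F \in subst_ctx y x X.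
Proof.
by move=> FX; rewrite /subst_ctx (perm_mem (perm_eq_seq_mset _)) map_f.
Qed.

(** The atom [r] is arbitrary because the premises of Eq1, Eq2, P and C put one atom, itself not
    substituted, next to the substituted set. *)
Lemma le_subst (r : ratom LVar) y x W :
  le (subst_label y x) W
    (World (r |` subst_rel y x (rels W)) (subst_ctx y x (ante W))
       (subst_ctx y x (succ W))).
Proof.
split=> [//|q qW|[] [a A] /= h].
- by apply: fset1Ur; rewrite /= in_imfset.
- by apply: coveredW; apply: in_subst_ctx h.
- by apply: coveredW; apply: in_subst_ctx h.
Qed.

Lemma subst_labelK (y : lab) x : subst_label y x (Lab x) = y.
Proof. by rewrite /subst_label eqxx. Qed.

Lemma subst_label_id (y : lab) x : subst_label y x y = y.
Proof. by rewrite /subst_label; case: ifP. Qed.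

(** Eq1 and Eq2 in continuation form: two labels that an atom forces to be equal may be assumed
    identified by a map to a later world. Eq1 eliminates [a] if it is a variable, Eq2 eliminates [b]
    if [a] is [Eps]. *)
Lemma unify_Eq W a b : (Eps, a, b) \in rels W ->
  (forall s W', le s W W' -> s a = s b -> cut_free W') -> cut_free W.
Proof.
move=> h k; case: (eqVneq a b) => [e|]; first exact: k (le_refl W) e.
(* Displaying an atom already present does not change the set, so the whole of [rels W] can serve as
   the side set of the rule and be substituted into. *)
rewrite /cut_free -(mem_fset1U h); case: a h k => [|v] h k.
  case: b h k => [//|v] h k _; apply: rule_Eq2.
  by apply: (k _ _ (le_subst _ _ _ _)); rewrite subst_labelK subst_label_id.
move=> _; apply: rule_Eq1.
by apply: (k _ _ (le_subst _ _ _ _)); rewrite subst_labelK subst_label_id.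
Qed.

(** P eliminates only a variable. Unless both labels are [Eps], one of them is a variable, and by
    symmetry it may be taken to be [b]. *)
Lemma unify_P W x y a b : (x, y, a) \in rels W -> (x, y, b) \in rels W ->
  (forall s W', le s W W' -> s a = s b -> cut_free W') -> cut_free W.
Proof.
wlog: a b / exists v, b = Lab v => [IH|[v ->] ha hb k].
  case: b => [|v]; last by apply: IH; exists v.
  case: a => [|v] ha hb k; first exact: k (le_refl W) _.
  by apply: (IH Eps (Lab v)) => //; [exists v|move=> s W' /k h /esym].
rewrite /cut_free -(mem_fset1U ha) -(mem_fset1U (fset1Ur (x, y, a) hb)).
rewrite fsetUCA; apply: rule_P.
by apply: (k _ _ (le_subst _ _ _ _)); rewrite subst_labelK subst_label_id.
Qed.

Lemma unify_C W x a b z : (x, a, z) \in rels W -> (x, b, z) \in rels W ->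
  (forall s W', le s W W' -> s a = s b -> cut_free W') -> cut_free W.
Proof.
wlog: a b / exists v, b = Lab v => [IH|[v ->] ha hb k].
  case: b => [|v]; last by apply: IH; exists v.
  case: a => [|v] ha hb k; first exact: k (le_refl W) _.
  by apply: (IH Eps (Lab v)) => //; [exists v|move=> s W' /k h /esym].
rewrite /cut_free -(mem_fset1U ha) -(mem_fset1U (fset1Ur (x, a, z) hb)).
rewrite fsetUCA; apply: rule_C.
by apply: (k _ _ (le_subst _ _ _ _)); rewrite subst_labelK subst_label_id.
Qed.

(** * Reflection: from coverage to forcing and refutation *)

(** Serves the passage from the conclusion of a left rule to a premise: one copy of the principal
    formula [P] is removed, and its components must cover it. *)
Lemma le_left P W W' : {subset rels W <= rels W'} ->
  {subset (ante W `\ P)%mset <= ante W'} -> {subset succ W <= succ W'} ->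
  covered true W' P.2 P.1 -> le id W W'.
Proof.
move=> hr hX hY hP; apply: le_id => // -[] [a A] /= h;
  last by apply: coveredW; apply: hY.
case: (in_mset_rem P h) => [e|/hX h']; last exact: coveredW.
by move: hP; rewrite -e.
Qed.

Lemma le_right P W W' : {subset rels W <= rels W'} ->
  {subset ante W <= ante W'} -> {subset (succ W `\ P)%mset <= succ W'} ->
  covered false W' P.2 P.1 -> le id W W'.
Proof.
move=> hr hX hY hP; apply: le_id => // -[] [a A] /= h;
  first by apply: coveredW; apply: hX.
case: (in_mset_rem P h) => [e|/hY h']; last exact: coveredW.
by move: hP; rewrite -e.
Qed.

Hypothesis LVar_infinite : forall s : seq LVar, exists x : LVar, x \notin s.

Ltac subs :=
  try by let h := fresh in intros ? h; rewrite /= ?in_mset1D ?in_fset1U h ?orbT.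
Ltac cov := by apply: coveredW; rewrite /= ?in_mset1D eqxx ?orbT.

(** The first half lets a formula covered on the left be assumed forced at some later world; the
    second says that a formula covered on the right is refuted. Where coverage comes from components
    (the [core] claims), the induction hypotheses suffice. Where the formula itself occurs, its rule
    is applied backwards; the premises are later worlds, to which forcing and refutation persist. *)
Lemma reflection A :
  (forall W a, covered true W A a -> refute A W a -> cut_free W) /\
  (forall W a, covered false W A a -> force A W a -> cut_free W).
Proof.
have inL W (P : lform PVar LVar) : P \in ante W ->
    ante W = (P +` (ante W `\ P))%mset.
  by move=> h; rewrite msetB1K.
have inR W (P : lform PVar LVar) : P \in succ W ->
    succ W = (P +` (succ W `\ P))%mset.
  by move=> h; rewrite msetB1K.
elim: A => [p|||B [lB rB] C [lC rC]|B [lB rB] C [lC rC]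
  ||B [lB rB] C [lC rC]|B [lB rB] C [lC rC]].
- split=> W a /= [] // h; first by move/refute_force; apply.
  by move=> h'; rewrite /cut_free (inL _ _ h') (inR _ _ h); apply: rule_id.
- split=> W a /= [] // h; first by move/refute_force; apply.
  by move=> _; rewrite /cut_free (inR _ _ h); apply: rule_TopR.
- split=> W a /= [] // h _.
  by rewrite /cut_free (inL _ _ h); apply: rule_BotL.
- split=> W a.
    (* The two components are forced one after the other, each at a later world; the first remains
       forced when the second is obtained. *)
    have core W0 : covered true W0 B a -> covered true W0 C a ->
        refute (And B C) W0 a -> cut_free W0.
      move=> cB cC r; apply: (lB _ _ cB) => s W' ss fB.
      apply: (lC W' (s a)) => [|t W'' tt fC]; first exact: covered_le cC.
      apply: r (le_trans ss tt) _.
      by split=> //; apply: force_le tt fB.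
    move=> /= [h|[cB cC]]; last exact: core.
    move=> r; rewrite /cut_free (inL _ _ h); apply: rule_AndL.
    set W' := World (rels W) ((a, B) +` ((a, C) +` (ante W `\ (a, And B C))))%mset (succ W).
    have cB : covered true W' B a by cov.
    have cC : covered true W' C a by cov.
    have ss : le id W W' by apply: (@le_left (a, And B C)) => //; subs; right.
    by apply: (core W' cB cC); apply: refute_le ss r.
  move=> /= [h|[cB|cC]] [fB fC]; [|exact: rB cB fB|exact: rC cC fC].
  rewrite /cut_free (inR _ _ h); apply: rule_AndR.
    set W' := World (rels W) (ante W) ((a, B) +` (succ W `\ (a, And B C)))%mset.
    have cB : covered false W' B a by cov.
    have ss : le id W W' by apply: (@le_right (a, And B C)) => //; subs; right; left.
    by apply: (rB W' _ cB); apply: force_le ss fB.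
  set W' := World (rels W) (ante W) ((a, C) +` (succ W `\ (a, And B C)))%mset.
  have cC : covered false W' C a by cov.
  have ss : le id W W' by apply: (@le_right (a, And B C)) => //; subs; right; right.
  by apply: (rC W' _ cC); apply: force_le ss fC.
- split=> W a.
    (* It suffices to force the implication, and any later world forcing [B] is cut-free derivable
       because [B] is covered there on the right. *)
    have core1 W0 : covered false W0 B a -> refute (Imp B C) W0 a -> cut_free W0.
      move=> cB /refute_force; apply=> /= s W' ss fB _.
      exact: rB (covered_le ss cB) fB.
    have core2 W0 : covered true W0 C a -> refute (Imp B C) W0 a -> cut_free W0.
      move=> cC /refute_force; apply=> /= s W' ss _.
      exact: lC (covered_le ss cC).
    move=> /= [h|[]]; [|exact: core1|exact: core2].
    move=> r; rewrite /cut_free (inL _ _ h); apply: rule_ImpL.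
      set W' := World (rels W) (ante W `\ (a, Imp B C))%mset ((a, B) +` succ W)%mset.
      have cB : covered false W' B a by cov.
      have ss : le id W W' by apply: (@le_left (a, Imp B C)) => //; subs; right; left.
      by apply: (core1 W' cB); apply: refute_le ss r.
    set W' := World (rels W) ((a, C) +` (ante W `\ (a, Imp B C)))%mset (succ W).
    have cC : covered true W' C a by cov.
    have ss : le id W W' by apply: (@le_left (a, Imp B C)) => //; subs; right; right.
    by apply: (core2 W' cC); apply: refute_le ss r.
  have core W0 : covered true W0 B a -> covered false W0 C a ->
      force (Imp B C) W0 a -> cut_free W0.
    move=> cB cC f; apply: (lB _ _ cB) => s W' ss fB.
    apply: (f _ _ ss fB) => t W'' tt; apply: rC.
    exact: covered_le (le_trans ss tt) cC.
  move=> /= [h|[cB cC]]; last exact: core.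
  move=> f; rewrite /cut_free (inR _ _ h); apply: rule_ImpR.
  set W' := World (rels W) ((a, B) +` ante W)%mset
    ((a, C) +` (succ W `\ (a, Imp B C)))%mset.
  have cB : covered true W' B a by cov.
  have cC : covered false W' C a by cov.
  have ss : le id W W' by apply: (@le_right (a, Imp B C)) => //; subs; right.
  by apply: (core W' cB cC); apply: (force_le (A := Imp B C) ss f).
- split=> W a.
    move=> /= [h|h]; last by move/refute_force; apply.
    move=> r; rewrite /cut_free (inL _ _ h); apply: rule_EmpL.
    set W' := World ((Eps, a, Eps) |` rels W) (ante W `\ (a, Emp))%mset (succ W).
    have hW' : (Eps, a, Eps) \in rels W' by rewrite fset1U1.
    have ss : le id W W' by apply: (@le_left (a, Emp)) => //; subs; right.
    exact: (r _ _ ss hW').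
  (* Forcing [Emp] at [a] yields the atom that lets [a] be unified with [Eps], after which the
     sequent is an instance of the axiom for [Emp]. *)
  move=> /= [h|//] /unify_Eq; apply=> s W' [s0 _ sc] sa.
  have {sc} := sc false _ h; rewrite /= sa s0 => -[{}h|//].
  by rewrite /cut_free (inR _ _ h); apply: rule_EmpR.
- split=> W a.
    have core W0 x y : (x, y, a) \in rels W0 ->
        covered true W0 B x -> covered true W0 C y ->
        refute (Star B C) W0 a -> cut_free W0.
      move=> h cB cC r; apply: (lB _ _ cB) => s W' ss fB.
      apply: (lC W' (s y)) => [|t W'' tt fC]; first exact: covered_le cC.
      have st := le_trans ss tt; apply: r (st) _.
      exists (t (s x)), (t (s y)); split=> //; last exact: force_le tt fB.
      by case: st => _ /(_ _ h).
    move=> /= [h|[x [y [h cB cC]]]]; last exact: core h cB cC.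
    move=> r; have [x frx _] := fresh_exists LVar_infinite (rels W) (ante W) (succ W) [::].
    have [y fry] := fresh_exists LVar_infinite (rels W) (ante W) (succ W) [:: x].
    rewrite inE eq_sym => xy.
    move: frx fry; rewrite /cut_free {1 2 3}(inL _ _ h) => frx fry.
    apply: rule_StarL xy frx fry _.
    set W' := World ((Lab x, Lab y, a) |` rels W)
      ((Lab x, B) +` ((Lab y, C) +` (ante W `\ (a, Star B C))))%mset (succ W).
    have cB : covered true W' B (Lab x) by cov.
    have cC : covered true W' C (Lab y) by cov.
    have hW' : (Lab x, Lab y, a) \in rels W' by rewrite fset1U1.
    have ss : le id W W'.
      by apply: (@le_left (a, Star B C)) => //; subs; right; exists (Lab x), (Lab y).
    by apply: (core W' _ _ hW' cB cC); apply: refute_le ss r.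
  move=> /= [h|//] [x [y [hr fB fC]]].
  (* This rule keeps its atom and its principal formula, so each premise is a mere weakening of the
     conclusion, hence a later world. *)
  rewrite /cut_free -(mem_fset1U hr) (inR _ _ h); apply: rule_StarR;
    rewrite (mem_fset1U hr) -(inR _ _ h).
    set W' := World (rels W) (ante W) ((x, B) +` succ W)%mset.
    have cB : covered false W' B x by cov.
    have ss : le id W W' := le_add_succ _ _.
    by apply: (rB W' _ cB); apply: force_le ss fB.
  set W' := World (rels W) (ante W) ((y, C) +` succ W)%mset.
  have cC : covered false W' C y by cov.
  have ss : le id W W' := le_add_succ _ _.
  by apply: (rC W' _ cC); apply: force_le ss fC.
- split=> W a.
    move=> /= [h|//] r; apply: (refute_force r) => /= s W' x y ss hr fB fC.
    (* On the left a [Wand] is covered only by its own occurrence, so it is still available at the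
       later world. *)
    have {h} [|//] : covered true W' (Wand B C) (s a).
      by apply: covered_le ss _; apply: coveredW.
    move=> h; rewrite /cut_free -(mem_fset1U hr) (inL _ _ h); apply: rule_WandL;
      rewrite (mem_fset1U hr) 1?msetDCA -(inL _ _ h).
      set W1 := World (rels W') (ante W') ((x, B) +` succ W')%mset.
      have cB : covered false W1 B x by cov.
      have tt : le id W' W1 := le_add_succ _ _.
      by apply: (rB W1 _ cB); apply: force_le tt fB.
    set W1 := World (rels W') ((y, C) +` ante W')%mset (succ W').
    have cC : covered true W1 C y by cov.
    have tt : le id W' W1 := le_add_ante _ _.
    by apply: (lC W1 _ cC); apply: (refute_le (A := C) tt fC).
  have core W0 x y : (x, a, y) \in rels W0 ->
      covered true W0 B x -> covered false W0 C y ->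
      force (Wand B C) W0 a -> cut_free W0.
    move=> h cB cC f; apply: (lB _ _ cB) => s W' ss fB.
    apply: (f s W' (s x) (s y) ss) => //; first by case: ss => _ /(_ _ h).
    move=> t W'' tt; apply: rC.
    exact: covered_le (le_trans ss tt) cC.
  move=> /= [h|[x [y [h cB cC]]]]; last exact: core h cB cC.
  move=> f; have [x frx _] := fresh_exists LVar_infinite (rels W) (ante W) (succ W) [::].
  have [y fry] := fresh_exists LVar_infinite (rels W) (ante W) (succ W) [:: x].
  rewrite inE eq_sym => xy.
  move: frx fry; rewrite /cut_free {1 2 3}(inR _ _ h) => frx fry.
  apply: rule_WandR xy frx fry _.
  set W' := World ((Lab x, a, Lab y) |` rels W)
    ((Lab x, B) +` ante W)%mset ((Lab y, C) +` (succ W `\ (a, Wand B C)))%mset.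
  have cB : covered true W' B (Lab x) by cov.
  have cC : covered false W' C (Lab y) by cov.
  have hW' : (Lab x, a, Lab y) \in rels W' by rewrite fset1U1.
  have ss : le id W W'.
    by apply: (@le_right (a, Wand B C)) => //; subs; right; exists (Lab x), (Lab y).
  by apply: (core W' _ _ hW' cB cC); apply: (force_le (A := Wand B C) ss f).
Qed.

(** * Soundness of the calculus with cut for the forcing semantics *)

(** [W] is a countermodel to the sequent under the valuation [s] of its labels. Soundness turns
    every such countermodel into a cut-free derivable world. *)
Record sat (s : lab -> lab) (W : world) (G : {fset ratom LVar})
    (X Y : {mset lform PVar LVar}) : Prop := Sat {
  satE : s Eps = Eps;
  satG : forall r, r \in G -> map_ratom s r \in rels W;
  satX : forall F, F \in X -> force F.2 W (s F.1);
  satY : forall F, F \in Y -> refute F.2 W (s F.1) }.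

Lemma sat_le s t W W' G X Y :
  le t W W' -> sat s W G X Y -> sat (t \o s) W' G X Y.
Proof.
move=> tt [s0 hG hX hY]; have [t0 tr _] := tt; split=> /=.
- by rewrite s0.
- by move=> r /hG/tr.
- by move=> F /hX; apply: force_le.
- by move=> F /hY; apply: refute_le.
Qed.

Lemma sat_addG s W r G X Y :
  sat s W (r |` G) X Y <-> map_ratom s r \in rels W /\ sat s W G X Y.
Proof.
split=> [[s0 hG hX hY]|[hr [s0 hG hX hY]]]; split=> //.
- by apply: hG; rewrite fset1U1.
- by split=> // q hq; apply: hG; apply: fset1Ur.
- by move=> q; rewrite in_fset1U => /orP[/eqP->|/hG].
Qed.

Lemma sat_addX s W F G X Y :
  sat s W G (F +` X)%mset Y <-> force F.2 W (s F.1) /\ sat s W G X Y.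
Proof.
split=> [[s0 hG hX hY]|[hr [s0 hG hX hY]]]; split=> //.
- by apply: hX; rewrite mset1D1.
- by split=> // q hq; apply: hX; apply: mset1Dr.
- by move=> q; rewrite in_mset1D => /orP[/eqP->|/hX].
Qed.

Lemma sat_addY s W F G X Y :
  sat s W G X (F +` Y)%mset <-> refute F.2 W (s F.1) /\ sat s W G X Y.
Proof.
split=> [[s0 hG hX hY]|[hr [s0 hG hX hY]]]; split=> //.
- by apply: hY; rewrite mset1D1.
- by split=> // q hq; apply: hY; apply: mset1Dr.
- by move=> q; rewrite in_mset1D => /orP[/eqP->|/hY].
Qed.

Definition update (s : lab -> lab) (x : LVar) (a b : lab) : lab :=
  if b == Lab x then a else s b.

Lemma sat_update s W G X Y x a :
  fresh x G X Y -> sat s W G X Y -> sat (update s x a) W G X Y.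
Proof.
move=> [fG fX fY] [s0 hG hX hY].
have upd b : Lab x != b -> update s x a b = s b.
  by rewrite /update eq_sym => /negPf ->.
split=> // [[[b c] d]|F|F] h.
- have := fG _ h; rewrite !inE !negb_or /= => /and3P[xb xc xd].
  by rewrite /map_ratom /= !upd //; apply: (hG _ h).
- by rewrite upd; [apply: hX|apply: fX].
- by rewrite upd; [apply: hY|apply: fY].
Qed.

(** A valuation that identifies [x] with [a] does not see the substitution. *)
Lemma sat_subst s W G X Y x a : s (Lab x) = s a -> sat s W G X Y ->
  sat s W (subst_rel a x G) (subst_ctx a x X) (subst_ctx a x Y).
Proof.
move=> e [s0 hG hX hY].
have es b : s (subst_label a x b) = s b.
  by rewrite /subst_label; case: eqP => [->|].
have ctx Z F : F \in subst_ctx a x Z -> exists2 F', F' \in Z & F = subst_lform a x F'.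
  by rewrite /subst_ctx (perm_mem (perm_eq_seq_mset _)) => /mapP.
split=> // [r|F /ctx[F' h ->]|F /ctx[F' h ->]].
- case/imfsetP => -[[b c] d] /= h ->.
  by rewrite /map_ratom /= !es; apply: (hG _ h).
- by rewrite /= es; apply: hX.
- by rewrite /= es; apply: hY.
Qed.

Lemma cut_free_U W x : cut_free (add_rel (x, Eps, x) W) -> cut_free W.
Proof. exact: rule_U. Qed.

(** Induction on the derivation. Logical rules follow from the clauses of [force]; structural rules
    are replayed backwards on the sequent of [W] itself, which moves to a later world. *)
Lemma soundness c G X Y : LS_PASL c G X Y ->
  forall s W, sat s W G X Y -> cut_free W.
Proof.
elim=> {G X Y}.
- move=> G X Y w p s W /sat_addX[f /sat_addY[r _]].
  exact: refute_force r f.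
- move=> G G' X X' Y Y' x A _ _ IH1 _ IH2 s W [s0 hG hX hY].
  have h1 : sat s W G X Y.
    split=> // [r h|F h|F h]; [apply: hG|apply: hX|apply: hY];
      by rewrite ?in_fsetU ?in_msetD h.
  have h2 : sat s W G' X' Y'.
    split=> // [r h|F h|F h]; [apply: hG|apply: hX|apply: hY];
      by rewrite ?in_fsetU ?in_msetD h orbT.
  (* Cut: the left premise needs [A] refuted at [W], and the right premise says just that, applied
     to any later world forcing [A]. *)
  apply: (IH1 s W); apply/sat_addY; split=> // t W' tt f.
  by apply: (IH2 (t \o s) W'); apply/sat_addX; split=> //; apply: sat_le h2.
- by move=> G X Y w s W /sat_addX[].
- by move=> G X Y w s W /sat_addY[r _]; apply: (refute_force r).
- move=> G X Y s W /sat_addY[/= r h].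
  (* The instance of U at [Eps] supplies the atom that forces [Emp] at [Eps]. *)
  apply: (@cut_free_U _ Eps); apply: (r id _ (le_add_rel _ _)).
  by rewrite /= (satE h) fset1U1.
- move=> G X Y w _ IH s W /sat_addX[/= f h]; apply: (IH s W).
  by apply/sat_addG; split=> //; rewrite /map_ratom /= (satE h).
- move=> G X Y w A B _ IH s W /sat_addX[/= [fA fB] h]; apply: (IH s W).
  by do 2 (apply/sat_addX; split=> //).
- move=> G X Y w A B _ IH1 _ IH2 s W /sat_addY[/= r h]; apply: (IH1 s W).
  apply/sat_addY; split=> // t W' tt fA; apply: (IH2 (t \o s) W').
  apply/sat_addY; split=> /=; last exact: sat_le h.
  move=> u W'' uu fB; apply: (r _ _ (le_trans tt uu)); split=> //.
  exact: force_le uu fA.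
- move=> G X Y w A B _ IH1 _ IH2 s W /sat_addX[/= f h]; apply: (IH1 s W).
  apply/sat_addY; split=> // t W' tt fA; apply: (f _ _ tt fA) => u W'' uu fB.
  apply: (IH2 (u \o (t \o s)) W''); apply/sat_addX; split=> //.
  by apply: sat_le uu _; apply: sat_le tt h.
- move=> G X Y w A B _ IH s W /sat_addY[/= r h].
  apply: (refute_force r) => t W' tt fA rB; apply: (IH (t \o s) W').
  by apply/sat_addX; split=> //; apply/sat_addY; split=> //; apply: sat_le h.
- move=> G X Y x y z A B xy fx fy _ IH s W h0.
  have /sat_addX[/= [a [b [hr fA fB]]] _] := h0.
  (* The eigenlabels [x] and [y] are revalued to the witnesses [a] and [b] of the forced [Star];
     freshness keeps the conclusion satisfied. *)
  have := sat_update b fy (sat_update a fx h0).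
  set s' := update _ _ _ => /sat_addX[_ h].
  have nz v : fresh v G ((z, Star A B) +` X)%mset Y -> (z == Lab v) = false.
    by case=> _ /(_ (z, Star A B)); rewrite mset1D1 eq_sym => /(_ isT)/negPf.
  have ex : s' (Lab x) = a.
    rewrite /s' /update; case: eqP => [[e]|_]; last by rewrite eqxx.
    by rewrite e eqxx in xy.
  have ey : s' (Lab y) = b by rewrite /s' /update eqxx.
  have ez : s' z = s z by rewrite /s' /update !nz.
  apply: (IH s' W); apply/sat_addG; rewrite /map_ratom /= ex ey ez; split=> //.
  by do 2 (apply/sat_addX; rewrite /= ?ex ?ey; split=> //).
- move=> G X Y x y z A B xy fx fy _ IH s W h0.
  (* It suffices to force the refuted [Wand]; its clause provides the values [a] and [b] for the
     eigenlabels. *)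
  have /sat_addY[/refute_force + _] := h0; apply=> t W' a b tt hr fA rB.
  have := sat_update b fy (sat_update a fx (sat_le tt h0)).
  set s' := update _ _ _ => /sat_addY[_ h].
  have nz v : fresh v G X ((z, Wand A B) +` Y)%mset -> (z == Lab v) = false.
    by case=> _ _ /(_ (z, Wand A B)); rewrite mset1D1 eq_sym => /(_ isT)/negPf.
  have ex : s' (Lab x) = a.
    rewrite /s' /update; case: eqP => [[e]|_]; last by rewrite eqxx.
    by rewrite e eqxx in xy.
  have ey : s' (Lab y) = b by rewrite /s' /update eqxx.
  have ez : s' z = t (s z) by rewrite /s' /update !nz.
  apply: (IH s' W'); apply/sat_addG; rewrite /map_ratom /= ex ey ez; split=> //.
  by apply/sat_addX; rewrite /= ex; split=> //; apply/sat_addY; rewrite /= ey.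
- move=> G X Y x y z A B _ IH1 _ IH2 s W h0.
  have /sat_addG[hr /sat_addY[/= r _]] := h0; apply: (IH1 s W).
  apply/sat_addY; split=> // t W' tt fA; apply: (IH2 (t \o s) W').
  apply/sat_addY; split=> /=; last exact: sat_le h0.
  move=> u W'' uu fB; have tu := le_trans tt uu; apply: (r _ _ tu).
  exists (u (t (s x))), (u (t (s y))); split=> //; last exact: force_le uu fA.
  by case: tu => _ /(_ _ hr).
- move=> G X Y x y z A B _ IH1 _ IH2 s W h0.
  have /sat_addG[hr /sat_addX[/= f _]] := h0; apply: (IH1 s W).
  apply/sat_addY; split=> // t W' tt fA.
  apply: (f _ _ _ (t (s z)) tt _ fA); first by case: tt => _ /(_ _ hr).
  move=> u W'' uu fB; apply: (IH2 (u \o (t \o s)) W'').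
  have := sat_le uu (sat_le tt h0).
  move=> /sat_addG[? /sat_addX[? ?]].
  by apply/sat_addG; split=> //; do 2 (apply/sat_addX; split=> //).
- move=> G X Y x y z _ IH s W h; have /sat_addG[hr _] := h.
  rewrite /cut_free -(mem_fset1U hr); apply: rule_E; rewrite (mem_fset1U hr).
  apply: (IH s (add_rel (s y, s x, s z) W)); apply/sat_addG; split.
    by rewrite fset1U1.
  exact: sat_le (le_add_rel _ _) h.
- move=> G X Y x y z u v w fw _ IH s W h.
  have /sat_addG[h1 /sat_addG[h2 _]] := h.
  (* Two eigenlabels are in play: [w] is fresh for the given conclusion, [w'] for the sequent of [W]
     on which the rule is replayed. The valuation sends [w] to [w']. *)
  have [w' fw' _] := fresh_exists LVar_infinite (rels W) (ante W) (succ W) [::].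
  have eW : (s x, s y, s z) |` ((s u, s v, s x) |` rels W) = rels W.
    by rewrite (mem_fset1U h2) (mem_fset1U h1).
  rewrite /cut_free -eW; apply: (@rule_A _ _ _ _ _ _ _ _ _ _ _ w'); rewrite eW //.
  pose W' := add_rel (s u, Lab w', s z) (add_rel (s y, s v, Lab w') W).
  have ss : le id W W' := le_trans (le_add_rel _ _) (le_add_rel _ _).
  have hw := sat_update (Lab w') fw (sat_le ss h).
  have up b : Lab w != b -> update s w (Lab w') b = s b.
    by rewrite /update eq_sym => /negPf ->.
  have [+ _ _] := fw => fr.
  have := fr (x, y, z); rewrite fset1U1 => /(_ isT).
  rewrite !inE !negb_or /= => /and3P[nx ny nz].
  have := fr (u, v, x); rewrite fset1Ur ?fset1U1 // => /(_ isT).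
  rewrite !inE !negb_or /= => /and3P[nu nv _].
  have ew : update s w (Lab w') (Lab w) = Lab w' by rewrite /update eqxx.
  apply: (IH (update s w (Lab w')) W').
  apply/sat_addG; split; first by rewrite /map_ratom /= ew !up // fset1U1.
  apply/sat_addG; split; last exact: hw.
  by rewrite /map_ratom /= ew !up // fset1Ur ?fset1U1.
- move=> G X Y x _ IH s W h; apply: (@cut_free_U _ (s x)).
  apply: (IH s (add_rel (s x, Eps, s x) W)); apply/sat_addG; split.
    by rewrite /map_ratom /= (satE h) fset1U1.
  exact: sat_le (le_add_rel _ _) h.
- move=> G X Y x y w fw _ IH s W h.
  have /sat_addG[h1 _] := h.
  have [w' fw' _] := fresh_exists LVar_infinite (rels W) (ante W) (succ W) [::].
  have eW := mem_fset1U h1.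
  rewrite /cut_free -eW; apply: (@rule_AC _ _ _ _ _ _ _ _ w'); rewrite eW //.
  pose W' := add_rel (s x, Lab w', s x) (add_rel (s y, s y, Lab w') W).
  have ss : le id W W' := le_trans (le_add_rel _ _) (le_add_rel _ _).
  have hw := sat_update (Lab w') fw (sat_le ss h).
  have up b : Lab w != b -> update s w (Lab w') b = s b.
    by rewrite /update eq_sym => /negPf ->.
  have [+ _ _] := fw => fr.
  have := fr (x, y, x); rewrite fset1U1 => /(_ isT).
  rewrite !inE !negb_or /= => /and3P[nx ny _].
  have ew : update s w (Lab w') (Lab w) = Lab w' by rewrite /update eqxx.
  apply: (IH (update s w (Lab w')) W').
  apply/sat_addG; split; first by rewrite /map_ratom /= ew !up // fset1U1.
  apply/sat_addG; split; last exact: hw.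
  by rewrite /map_ratom /= ew !up // fset1Ur ?fset1U1.
- move=> G X Y w w' _ IH s W /sat_addG[hr h].
  rewrite /map_ratom /= (satE h) in hr.
  (* The values of [w] and [w'] may differ in [W]; once [t] has unified them, [t \o s] satisfies the
     substituted premise. *)
  apply: (unify_Eq hr) => t W' tt e; apply: (IH (t \o s) W').
  have h' := sat_le tt h.
  apply/sat_addG; split; last exact: sat_subst.
  by case: tt => t0 /(_ _ hr) + _; rewrite /map_ratom /= (satE h) t0 e.
- move=> G X Y w w' _ IH s W /sat_addG[hr h].
  rewrite /map_ratom /= (satE h) in hr.
  apply: (unify_Eq hr) => t W' tt e; apply: (IH (t \o s) W').
  have h' := sat_le tt h.
  apply/sat_addG; split; last by apply: sat_subst.
  by case: tt => t0 /(_ _ hr) + _; rewrite /map_ratom /= (satE h) t0 e.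
- move=> G X Y x y z w _ IH s W /sat_addG[h1 /sat_addG[h2 h]].
  apply: (unify_P h1 h2) => t W' tt e; apply: (IH (t \o s) W').
  apply/sat_addG; split; first by case: tt => _ /(_ _ h1).
  by apply: sat_subst; last exact: sat_le h.
- move=> G X Y x y z w _ IH s W /sat_addG[h1 /sat_addG[h2 h]].
  apply: (unify_C h1 h2) => t W' tt e; apply: (IH (t \o s) W').
  apply/sat_addG; split; first by case: tt => _ /(_ _ h1).
  by apply: sat_subst; last exact: sat_le h.
Qed.

(** * Evaluation of a derivation at its own end-sequent *)

(** [reflection] forces one formula at a time, each at a later world. Iterating it works because the
    remaining formulas stay covered and those already treated stay forced. *)
Lemma force_ante (l : seq (lform PVar LVar)) s W :
  (forall F, F \in l -> covered true W F.2 (s F.1)) ->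
  (forall t W', le t W W' ->
     (forall F, F \in l -> force F.2 W' (t (s F.1))) -> cut_free W') ->
  cut_free W.
Proof.
elim: l s W => [|F l IH] s W hc k; first exact: k (le_refl W) _.
apply: ((reflection F.2).1 W (s F.1)) => [|t W' tt fF].
  by apply: hc; rewrite mem_head.
apply: (IH (t \o s) W') => [K Kl|u W'' uu fl].
  by apply: covered_le tt _; apply: hc; rewrite in_cons Kl orbT.
apply: k (le_trans tt uu) _ => K; rewrite in_cons => /orP[/eqP->|/fl //].
exact: force_le uu fF.
Qed.

End Forcing.

Theorem mainTheorem2 (PVar LVar : choiceType)
    (LVar_infinite : forall s : seq LVar, exists x : LVar, x \notin s)
    (G : {fset ratom LVar})
    (Gamma Delta : {mset lform PVar LVar}%mset) :
  derivable G Gamma Delta -> cut_free_derivable G Gamma Delta.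
Proof.
move=> d; pose W := World G Gamma Delta.
apply: (@force_ante _ _ LVar_infinite Gamma id W) => [[a A] /= h|s W' ss fX].
  exact: coveredW.
apply: (soundness LVar_infinite d (s := s)); have [s0 sr sc] := ss; split=> //.
(* The succedent formulas are still covered on the right at every world after [W], hence refuted at
   [W']. *)
move=> F FY t W'' tt; apply: (reflection LVar_infinite F.2).2.
by apply: covered_le tt _; apply: (sc false).
Qed.
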